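(* Let $k$ be an algebraically closed field of characteristic $2$, and let $G$ and $H$ be finite groups. Let $M$ be an $H\times G$-bimodule inducing a Morita equivalence between a block $B_G$ of $kG$ and a block $B_H$ of $kH$. If $M$ is of symmetric type, then the equivalence preserves the property ''being of quadratic type'' on projective modules: if $P$ is a projective left $B_G$-module of quadratic type, then the projective left $B_H$-module $M\otimes_{kG}P$ is of quadratic type.
   Context: All modules are finite-dimensional over $k$. An $H\times G$-bimodule is a $k$-vector space with a left $kH$-action and a commuting right $kG$-action. A $k$-bilinear form $(\cdot,\cdot)$ on an $H\times G$-bimodule $M$ is $H\times G$-invariant if $(hmg,hng)=(m,n)$ for all $h\in H$, $g\in G$, $m,n\in M$. $M$ is of symmetric type if it carries a non-degenerate $H\times G$-invariant symmetric $k$-bilinear form. For a finite group $\Gamma$, a self-dual left $k\Gamma$-module $T$ (that is, $T\cong T^*=\mathrm{Hom}_k(T,k)$ with $(gf)(t)=f(g^{-1}t)$) is of quadratic type if it carries a non-degenerate $\Gamma$-invariant quadratic form $Q$, where $\Gamma$-invariant means $Q(gt)=Q(t)$ for all $g\in\Gamma$, $t\in T$. The polarisation of $Q$ is the form $B(v,v')=Q(v+v')-Q(v)-Q(v')$, and $Q$ is non-degenerate if $\mathrm{rad}\,Q:=\{v\in \mathrm{rad}\,B : Q(v)=0\}=0$, where $\mathrm{rad}\,B=\{v : B(v,v')=0 \text{ for all } v'\}$. A block of $kG$ is an indecomposable two-sided direct factor of the algebra $kG$. An $H\times G$-bimodule $M$ induces a Morita equivalence between $B_G$ and $B_H$ if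 $M$ is a progenerator as a left $B_H$-module and as a right $B_G$-module and the functor $V\mapsto M\otimes_{kG}V$ is an equivalence from the category of left $B_G$-modules onto the category of left $B_H$-modules. *)

(* Defs.v *)
From HB Require Import structures.
From mathcomp Require Import all_boot all_order all_fingroup all_algebra.
From mathcomp Require Import falgebra.
From mathcomp Require Import boolp.

Set Implicit Arguments.
Unset Strict Implicit.
Unset Printing Implicit Defensive.

Import GRing.Theory.
Local Open Scope ring_scope.

Record category := Category {
  obj :> Type;
  mor : obj -> obj -> Type;
  idm : forall a, mor a a;
  mcomp : forall a b c, mor b c -> mor a b -> mor a c;
  mcomp1m : forall a b (f : mor a b), mcomp (idm b) f = f;
  mcompm1 : forall a b (f : mor a b), mcomp f (idm a) = f;
  mcompA : forall a b c d (h : mor c d) (g : mor b c) (f : mor a b),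
    mcomp h (mcomp g f) = mcomp (mcomp h g) f }.

Record functor (C D : category) := Functor {
  fobj :> C -> D;
  fmap : forall a b, mor a b -> mor (fobj a) (fobj b);
  fmap1 : forall a, fmap (idm a) = idm (fobj a);
  fmapM : forall a b c (g : mor b c) (f : mor a b),
    fmap (mcomp g f) = mcomp (fmap g) (fmap f) }.
Arguments fmap {C D} F {a b} : rename.

Definition idF (C : category) : functor C C.
Proof. by exists id (fun _ _ => id). Defined.

Definition compF (C D E : category) (G : functor D E) (F : functor C D) :
  functor C E.
Proof.
exists (fun a => G (F a)) (fun a b f => fmap G (fmap F f)).
- by move=> a; rewrite !fmap1.
- by move=> a b c g f; rewrite !fmapM.
Defined.

Definition nat_iso (C D : category) (F G : functor C D) : Prop :=
  exists (eta : forall a, mor (F a) (G a)) (eps : forall a, mor (G a) (F a)),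
    [/\ forall a, mcomp (eps a) (eta a) = idm (F a),
        forall a, mcomp (eta a) (eps a) = idm (G a)
      & forall a b (f : mor a b),
          mcomp (eta b) (fmap F f) = mcomp (fmap G f) (eta a)].

Definition equivalence (C D : category) (F : functor C D) : Prop :=
  exists G : functor D C,
    nat_iso (compF G F) (idF C) /\ nat_iso (compF F G) (idF D).

Section Converse.
Variables (k : fieldType) (A : algType k).

HB.instance Definition _ := GRing.Zmodule_isLmodule.Build k A^c
  (@scalerA k A) (@scale1r k A) (@scalerDr k A) (@scalerDl k A).

Fact conv_scalerAl (c : k) (x y : A^c) : c *: (x * y) = (c *: x) * y.
Proof. exact: (scalerAr c (y : A) (x : A)). Qed.
HB.instance Definition _ := GRing.Lmodule_isLalgebra.Build k A^c conv_scalerAl.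

Fact conv_scalerAr (c : k) (x y : A^c) : c *: (x * y) = x * (c *: y).
Proof. exact: (scalerAl c (y : A) (x : A)). Qed.
HB.instance Definition _ := GRing.Lalgebra_isAlgebra.Build k A^c conv_scalerAr.
End Converse.

(* Left modules; right A-modules are left modules over A^c. *)
Record lmodule (k : fieldType) (A : algType k) := LModule {
  mod_sp :> vectType k;
  mod_act : A -> 'End(mod_sp);
  mod_act_linear : linear mod_act;
  mod_act1 : mod_act 1 = \1%VF;
  mod_actM : forall a b, mod_act (a * b) = (mod_act a \o mod_act b)%VF }.

HB.instance Definition _ (k : fieldType) (A : algType k) (V : lmodule A) :=
  GRing.isLinear.Build k A 'End(V) _ (mod_act V) (mod_act_linear V).

Record mhom (k : fieldType) (A : algType k) (V W : lmodule A) := MHom {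
  mfun :> 'Hom(V, W);
  mhomP : forall a v, mfun (mod_act V a v) = mod_act W a (mfun v) }.

Definition iso_mod (k : fieldType) (A : algType k) (V W : lmodule A) : Prop :=
  exists f : mhom V W, bijective f.

Section ModuleCategory.
Variables (k : fieldType) (A : algType k).

Lemma mhom_eq (V W : lmodule A) (f g : mhom V W) : f =1 g -> f = g.
Proof.
case: f g => [f fP] [g gP] /= efg; have {}efg: f = g by apply/lfunP.
by subst g; rewrite (Prop_irrelevance fP gP).
Qed.

Definition mhom_id (V : lmodule A) : mhom V V.
Proof. by exists \1%VF => a v; rewrite !id_lfunE. Defined.

Definition mhom_comp (U V W : lmodule A) (g : mhom V W) (f : mhom U V) :
  mhom U W.
Proof. by exists (g \o f)%VF => a v; rewrite !comp_lfunE !mhomP. Defined.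

(* For a central idempotent e, the modules over the direct factor Ae of A,  *)
(* viewed as the A-modules on which its identity e acts as the identity.    *)
Record fmod (e : A) := FMod {
  fmod_mod :> lmodule A;
  fmodP : mod_act fmod_mod e = \1%VF }.

Definition fmod_cat (e : A) : category.
Proof.
exists (fmod e) (fun V W => mhom V W) (fun V => mhom_id V)
  (fun U V W g f => mhom_comp g f).
- by move=> V W f; apply: mhom_eq => v; rewrite comp_lfunE id_lfunE.
- by move=> V W f; apply: mhom_eq => v; rewrite comp_lfunE id_lfunE.
- by move=> U V W X h g f; apply: mhom_eq => v; rewrite !comp_lfunE.
Defined.

Definition projective (e : A) (P : fmod e) : Prop :=
  forall (X Y : fmod e) (p : mhom X Y) (f : mhom P Y),
    limg p = fullv -> exists g : mhom P X, forall v, p (g v) = f v.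

Definition generator (e : A) (P : fmod e) : Prop :=
  forall X : fmod e, exists (n : nat) (f : 'I_n -> mhom P X),
    (\sum_i limg (f i))%VS = fullv.

Definition progenerator (e : A) (P : fmod e) : Prop :=
  projective P /\ generator P.
End ModuleCategory.

Section Blocks.
Variables (k : fieldType) (A : falgType k).

Definition ideal (I : {vspace A}) : Prop :=
  (fullv * I <= I)%VS /\ (I * fullv <= I)%VS.

Definition direct_factor (B : {vspace A}) : Prop :=
  ideal B /\ exists I : {vspace A},
    [/\ ideal I, (B + I)%VS = fullv & (B :&: I)%VS = 0%VS].

Definition indecomposable (B : {vspace A}) : Prop :=
  B <> 0%VS /\ forall I J : {vspace A}, ideal I -> ideal J ->
    (I + J)%VS = B -> (I :&: J)%VS = 0%VS -> I = 0%VS \/ J = 0%VS.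

(* A nonzero direct factor of A is an algebra whose identity [algid B] need *)
(* not be 1, hence the use of {aspace A}.                                   *)
Definition block (B : {aspace A}) : Prop :=
  direct_factor B /\ indecomposable B.
End Blocks.

Record bimodule (k : fieldType) (A B : algType k) := Bimodule {
  bsp :> vectType k;
  lact : A -> 'End(bsp);
  ract : B -> 'End(bsp);
  lact_linear : linear lact;
  ract_linear : linear ract;
  lact1 : lact 1 = \1%VF;
  lactM : forall a a', lact (a * a') = (lact a \o lact a')%VF;
  ract1 : ract 1 = \1%VF;
  ractM : forall b b', ract (b * b') = (ract b' \o ract b)%VF;
  lractC : forall a b m, lact a (ract b m) = ract b (lact a m) }.

HB.instance Definition _ (k : fieldType) (A B : algType k)
    (M : bimodule A B) :=
  GRing.isLinear.Build k A 'End(M) _ (lact M) (lact_linear M).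
HB.instance Definition _ (k : fieldType) (A B : algType k)
    (M : bimodule A B) :=
  GRing.isLinear.Build k B 'End(M) _ (ract M) (ract_linear M).

Section Sides.
Variables (k : fieldType) (A B : algType k) (M : bimodule A B).

Definition lside : lmodule A :=
  LModule (lact_linear M) (lact1 M) (lactM M).

Definition rside : lmodule B^c :=
  @LModule k B^c M (ract M) (ract_linear M) (ract1 M)
    (fun b b' => ractM M b' b).
End Sides.

Import VectorInternalTheory.

(* U (x)_k V, realised as the space of coefficient matrices with respect to *)
(* the coordinate systems [v2r] of U and V.                                 *)
Section TensorOverField.
Variable k : fieldType.
Implicit Types U V W : vectType k.

Definition tens U V : vectType k := 'M[k]_(dim U, dim V).

Definition pure U V (u : U) (v : V) : tens U V := (v2r u)^T *m v2r v.

Definition tmap U U' V V' (f : 'Hom(U, U')) (g : 'Hom(V, V')) :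
    'Hom(tens U V, tens U' V') :=
  linfun (mulmxr (f2mx g) \o mulmx (f2mx f)^T).

Lemma pure_linearl U V (v : V) : linear (fun u : U => pure u v).
Proof. by move=> a x y; rewrite /pure !linearP /= mulmxDl -scalemxAl. Qed.

Lemma pure_linearr U V (u : U) : linear (fun v : V => pure u v).
Proof. by move=> a x y; rewrite /pure !linearP. Qed.

Lemma lfun_v2r U V (f : 'Hom(U, V)) u : v2r (f u) = v2r u *m f2mx f.
Proof. by rewrite unlock /= r2vK. Qed.

Lemma tmap_pure U U' V V' (f : 'Hom(U, U')) (g : 'Hom(V, V')) u v :
  tmap f g (pure u v) = pure (f u) (g v).
Proof. by rewrite lfunE /= /pure !lfun_v2r trmx_mul !mulmxA. Qed.

Lemma tens_sum U V (T : tens U V) :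
  T = \sum_i \sum_j T i j *: pure (r2v (delta_mx 0 i)) (r2v (delta_mx 0 j)).
Proof.
rewrite {1}(matrix_sum_delta T); apply: eq_bigr => i _; apply: eq_bigr => j _.
by rewrite /pure !r2vK trmx_delta mul_delta_mx.
Qed.

Lemma tens_eq U V W (f g : 'Hom(tens U V, W)) :
  (forall u v, f (pure u v) = g (pure u v)) -> f = g.
Proof.
move=> efg; apply/lfunP=> T; rewrite (tens_sum T) !linear_sum.
apply: eq_bigr => i _; rewrite !linear_sum; apply: eq_bigr => j _.
by rewrite !linearZ /= efg.
Qed.

Lemma tens_lift U V W (b : {bilinear U -> V -> W}) :
  exists f : 'Hom(tens U V, W), forall u v, f (pure u v) = b u v.
Proof.
pose F (T : tens U V) : W :=
  \sum_i \sum_j T i j *: b (r2v (delta_mx 0 i)) (r2v (delta_mx 0 j)).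
have Flin : linear F.
  move=> a x y; rewrite /F scaler_sumr -big_split; apply: eq_bigr => i _ /=.
  rewrite scaler_sumr -big_split; apply: eq_bigr => j _ /=.
  by rewrite !mxE scalerDl scalerA.
pose FL := HB.pack_for {linear tens U V -> W} F
  (GRing.isLinear.Build _ _ _ _ F Flin).
exists (linfun FL) => u v; rewrite lfunE /= /F.
have dec (X : vectType k) (x : X) : x = \sum_i v2r x 0 i *: r2v (delta_mx 0 i).
  rewrite -{1}(v2rK x) {1}(row_sum_delta (v2r x)) linear_sum.
  by apply: eq_bigr => i _; rewrite linearZ.
rewrite [in RHS](dec _ u) linear_sumlz; apply: eq_bigr => i _.
rewrite linearZl_LR [in RHS](dec _ v) linear_sumr scaler_sumr.
apply: eq_bigr => j _.
by rewrite linearZr_LR /= scalerA /pure mxE big_ord1 mxE.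
Qed.
End TensorOverField.

Section Quotient.
Variable k : fieldType.
Implicit Types V W : vectType k.

(* V / N, realised on a complement of N. *)
Definition quo V (N : {vspace V}) : vectType k := subvs_of (N^C)%VS.

Definition qpi V (N : {vspace V}) : 'Hom(V, quo N) :=
  linfun (vsproj (N^C) \o daddv_pi (N^C) N).

Definition qmap V W (N : {vspace V}) (N' : {vspace W}) (f : 'Hom(V, W)) :
    'Hom(quo N, quo N') :=
  (qpi N' \o f \o linfun vsval)%VF.

Lemma qpi_val V (N : {vspace V}) (x : quo N) : qpi N (vsval x) = x.
Proof.
by rewrite lfunE /= daddv_pi_id ?vsvalK ?subvsP // capvC capv_compl.
Qed.

Lemma lker_qpi V (N : {vspace V}) : lker (qpi N) = N.
Proof.
have dirN : (N^C :&: N = 0)%VS by rewrite capvC capv_compl.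
have valq v : vsval (qpi N v) = daddv_pi (N^C) N v.
  by rewrite lfunE /= vsprojK ?memv_pi.
apply/vspaceP => v; rewrite memv_ker.
have dv : daddv_pi (N^C) N v + daddv_pi N (N^C) v = v.
  by apply: daddv_pi_add => //; rewrite addvC addv_complf memvf.
apply/eqP/idP => [v0|Nv].
  by rewrite -dv -valq v0 linear0 add0r memv_pi.
apply: val_inj; rewrite linear0 [LHS]valq.
apply: (addIr (daddv_pi N (N^C)%VS v)).
by rewrite dv add0r daddv_pi_id ?capv_compl.
Qed.

Lemma qpi_eq V (N : {vspace V}) v w : qpi N v = qpi N w <-> v - w \in N.
Proof.
rewrite -[in X in _ <-> X](lker_qpi N) memv_ker linearB subr_eq0.
by split=> /eqP.
Qed.

Lemma qmap_pi V W (N : {vspace V}) (N' : {vspace W}) (f : 'Hom(V, W)) v :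
  (f @: N <= N')%VS -> qmap N N' f (qpi N v) = qpi N' (f v).
Proof.
move=> /subvP sfN; rewrite !comp_lfunE; apply/qpi_eq; rewrite -linearB.
apply: sfN; apply: memv_img; apply/qpi_eq.
by rewrite [linfun vsval _]lfunE qpi_val.
Qed.

Lemma quo_eq V W (N : {vspace V}) (f g : 'Hom(quo N, W)) :
  (forall v, f (qpi N v) = g (qpi N v)) -> f = g.
Proof. by move=> efg; apply/lfunP => x; rewrite -(qpi_val x). Qed.
End Quotient.

Section TensorProduct.
Variables (k : fieldType) (A B : falgType k) (M : bimodule A B).
Implicit Types V W : lmodule B.

Definition bal V (b : B) : 'End(tens M V) :=
  (tmap (ract M b) \1 - tmap \1 (mod_act V b))%VF.

(* The span of all mb (x) v - m (x) bv with b in a basis of B, hence with   *)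
(* b arbitrary: see [bal_in]. The quotient has the universal property of    *)
(* the tensor product over B: see [tpure_bal] and [tprod_lift].             *)
Definition relations V : {vspace tens M V} :=
  (\sum_(i < \dim {:B}) limg (bal V (vbasis {:B})`_i))%VS.

Definition tprod V : vectType k := quo (relations V).

Definition tpure V (m : M) (v : V) : tprod V := qpi (relations V) (pure m v).

Lemma bal_pure V b m v :
  bal V b (pure m v) = pure (ract M b m) v - pure m (mod_act V b v).
Proof. by rewrite !lfunE /= opp_lfunE !tmap_pure !id_lfunE. Qed.

Lemma bal_linear V : linear (bal V).
Proof.
move=> a b c; apply: tens_eq => m v.
rewrite bal_pure [RHS]add_lfunE scale_lfunE !bal_pure !linearP /=.
rewrite !add_lfunE !scale_lfunE.
by rewrite pure_linearl pure_linearr scalerBr opprD addrACA.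
Qed.

Lemma bal_in V b T : bal V b T \in relations V.
Proof.
rewrite (coord_vbasis (memvf b)).
pose BL := HB.pack_for {linear B -> 'End(tens M V)} (bal V)
  (GRing.isLinear.Build _ _ _ _ (bal V) (@bal_linear V)).
rewrite -[bal V]/(BL : B -> _) linear_sum sum_lfunE.
apply: rpred_sum => i _; rewrite linearZ scale_lfunE rpredZ //.
have /subvP : (limg (bal V (vbasis {:B})`_i) <= relations V)%VS.
  exact: (sumv_sup i).
by apply; apply: memv_img; apply: memvf.
Qed.

Lemma relations_sub V (W : vectType k) (f : 'Hom(tens M V, W))
    (U : {vspace W}) :
  (forall b m v, f (bal V b (pure m v)) \in U) -> (f @: relations V <= U)%VS.
Proof.
move=> fU; apply/subvP => _ /memv_imgP[T + ->].
case/memv_sumP => S SP ->; rewrite linear_sum; apply: rpred_sum => i _.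
have /memv_imgP[R _ ->] := SP i isT.
rewrite (tens_sum R) !linear_sum; apply: rpred_sum => j _.
rewrite !linear_sum; apply: rpred_sum => l _.
by rewrite !linearZ; apply: rpredZ; apply: fU.
Qed.

Lemma tpure_bal V b (m : M) (v : V) :
  tpure (ract M b m) v = tpure m (mod_act V b v).
Proof. by apply/qpi_eq; rewrite -bal_pure bal_in. Qed.

Lemma tprod_eq V (W : vectType k) (f g : 'Hom(tprod V, W)) :
  (forall m v, f (tpure m v) = g (tpure m v)) -> f = g.
Proof.
move=> efg; apply: quo_eq => T; rewrite -!comp_lfunE; move: T; apply/lfunP.
by apply: tens_eq => m v; rewrite !comp_lfunE efg.
Qed.

Lemma tprod_lift V (W : vectType k) (b : {bilinear M -> V -> W}) :
  (forall x m v, b (ract M x m) v = b m (mod_act V x v)) ->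
  exists! f : 'Hom(tprod V, W), forall m v, f (tpure m v) = b m v.
Proof.
move=> bB; have [f fE] := tens_lift b.
have f0 T : T \in relations V -> f T = 0.
  move=> TN; apply/eqP; rewrite -memv0.
  have sf0 : (f @: relations V <= 0)%VS.
    apply: relations_sub => x m v.
    by rewrite bal_pure linearB /= !fE bB subrr memv0.
  exact: (subvP sf0) (memv_img f TN).
exists (f \o linfun vsval)%VF; split=> [m v|g gE].
  rewrite comp_lfunE [linfun vsval _]lfunE -fE; apply/eqP.
  rewrite -subr_eq0 -linearB.
  by apply/eqP/f0/qpi_eq; rewrite qpi_val.
apply: tprod_eq => m v; rewrite gE comp_lfunE [linfun vsval _]lfunE -fE.
apply/eqP; rewrite -subr_eq0 -linearB; apply/eqP/f0/qpi_eq.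
by rewrite qpi_val.
Qed.

Definition tact V (a : A) : 'End(tprod V) :=
  qmap (relations V) (relations V) (tmap (lact M a) \1).

Lemma tact_pure V a (m : M) (v : V) :
  tact V a (tpure m v) = tpure (lact M a m) v.
Proof.
rewrite /tact qmap_pi ?tmap_pure ?id_lfunE //; apply: relations_sub => b m' v'.
rewrite bal_pure linearB /= !tmap_pure !id_lfunE lractC -bal_pure.
exact: bal_in.
Qed.

Lemma tpure_linearl V (v : V) : linear (fun m => tpure m v).
Proof. by move=> c x y; rewrite /tpure pure_linearl linearP. Qed.

Lemma tpure_linearr V (m : M) : linear (fun v : V => tpure m v).
Proof. by move=> c x y; rewrite /tpure pure_linearr linearP. Qed.

Fact tact_linear V : linear (tact V).
Proof.
move=> c x y; apply: tprod_eq => m v; rewrite add_lfunE scale_lfunE !tact_pure.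
by rewrite linearP add_lfunE scale_lfunE tpure_linearl.
Qed.

Fact tact1 V : tact V 1 = \1%VF.
Proof. by apply: tprod_eq => m v; rewrite tact_pure lact1 !id_lfunE. Qed.

Fact tactM V a a' : tact V (a * a') = (tact V a \o tact V a')%VF.
Proof.
by apply: tprod_eq => m v; rewrite comp_lfunE !tact_pure lactM comp_lfunE.
Qed.

Definition tensor V : lmodule A :=
  LModule (@tact_linear V) (@tact1 V) (@tactM V).

Lemma mod_act_tensor V a (m : M) (v : V) :
  mod_act (tensor V) a (tpure m v) = tpure (lact M a m) v.
Proof. exact: tact_pure. Qed.

Definition tensor_fun V W (f : mhom V W) : 'Hom(tensor V, tensor W) :=
  qmap (relations V) (relations W) (tmap \1 f).

Lemma tensor_fun_pure V W (f : mhom V W) (m : M) (v : V) :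
  tensor_fun f (tpure m v) = tpure m (f v).
Proof.
rewrite /tensor_fun qmap_pi ?tmap_pure ?id_lfunE //.
apply: relations_sub => b m' v'.
rewrite bal_pure linearB /= !tmap_pure !id_lfunE mhomP -bal_pure.
exact: bal_in.
Qed.

Fact tensor_funP V W (f : mhom V W) a x :
  tensor_fun f (mod_act (tensor V) a x) = mod_act (tensor W) a (tensor_fun f x).
Proof.
rewrite -!comp_lfunE; move: x; apply/lfunP; apply: tprod_eq => m v.
rewrite [LHS]comp_lfunE [RHS]comp_lfunE mod_act_tensor.
by rewrite !tensor_fun_pure mod_act_tensor.
Qed.

Definition tensor_hom V W (f : mhom V W) : mhom (tensor V) (tensor W) :=
  MHom (tensor_funP f).
End TensorProduct.

Section Morita.
Variables (k : fieldType) (A B : falgType k) (M : bimodule A B).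
Variables (e : A) (f : B) (eM : mod_act (lside M) e = \1%VF).

Fact tensor_fmodP (V : lmodule B) : mod_act (tensor M V) e = \1%VF.
Proof.
apply: tprod_eq => m v; rewrite mod_act_tensor id_lfunE.
by have /= -> := eM; rewrite id_lfunE.
Qed.

Definition tensor_fmod (V : lmodule B) : fmod e := FMod (tensor_fmodP V).

Definition tensor_functor : functor (fmod_cat f) (fmod_cat e).
Proof.
exists (fun V : fmod f => tensor_fmod V : fmod_cat e)
  (fun (V W : fmod f) (g : mhom V W) => tensor_hom M g).
- move=> V; apply: mhom_eq => x; congr (fun_of_lfun _ x).
  by apply: tprod_eq => m v; rewrite tensor_fun_pure !id_lfunE.
- move=> U V W h g; apply: mhom_eq => x; congr (fun_of_lfun _ x).
  apply: tprod_eq => m v.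
  by rewrite [RHS]comp_lfunE !tensor_fun_pure comp_lfunE.
Defined.
End Morita.

(* M induces a Morita equivalence between the direct factors BB of B and BA *)
(* of A; the first two fields say that M is a (BA, BB)-bimodule.            *)
Record morita (k : fieldType) (A B : falgType k) (M : bimodule A B)
    (BA : {aspace A}) (BB : {aspace B}) : Prop := Morita {
  morita_l : mod_act (lside M) (algid BA) = \1%VF;
  morita_r : mod_act (rside M) (algid BB) = \1%VF;
  morita_progen_l : progenerator (FMod morita_l);
  morita_progen_r : progenerator (FMod morita_r);
  morita_equiv : equivalence (tensor_functor (algid BB) morita_l) }.

(* A function gT -> k stands for the linear combination of group elements   *)
(* with these coefficients ([gr_sum]); the product is convolution.          *)
Definition gralg (k : fieldType) (gT : finGroupType) : Type :=
  {ffun gT -> k^o}.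

Section GroupAlgebra.
Variables (k : fieldType) (gT : finGroupType).
Local Notation kG := (gralg k gT).

HB.instance Definition _ := Vector.copy kG {ffun gT -> k^o}.

Definition gr (g : gT) : kG := [ffun x => (x == g)%:R].

Definition gr_mul (a b : kG) : kG :=
  [ffun x => \sum_y a y * b (y^-1 * x)%g].

Fact gr_mulDl : left_distributive gr_mul +%R.
Proof.
move=> a b c; apply/ffunP => x; rewrite !ffunE -big_split.
by apply: eq_bigr => y _; rewrite ffunE mulrDl.
Qed.

Fact gr_mulDr : right_distributive gr_mul +%R.
Proof.
move=> a b c; apply/ffunP => x; rewrite !ffunE -big_split.
by apply: eq_bigr => y _; rewrite ffunE mulrDr.
Qed.

Fact gr_mulA : associative gr_mul.
Proof.
move=> a b c; apply/ffunP => x; rewrite !ffunE.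
under eq_bigr => y _ do rewrite ffunE big_distrr /=.
under [RHS]eq_bigr => z _ do rewrite ffunE big_distrl /=.
rewrite [RHS]exchange_big /=; apply: eq_bigr => y _.
rewrite [RHS](reindex_inj (mulgI y)) /=; apply: eq_bigr => z _.
by rewrite mulrA mulKg invMg mulgA.
Qed.

Fact gr_mul1 : left_id (gr 1) gr_mul.
Proof.
move=> a; apply/ffunP => x; rewrite ffunE (bigD1 1%g) //= big1 => [|y ny1].
  by rewrite ffunE eqxx mul1r invg1 mul1g addr0.
by rewrite ffunE (negPf ny1) mul0r.
Qed.

Fact gr_mulr1 : right_id (gr 1) gr_mul.
Proof.
move=> a; apply/ffunP => x; rewrite ffunE (bigD1 x) //= big1 => [|y nyx].
  by rewrite ffunE mulVg eqxx mulr1 addr0.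
by rewrite ffunE -eq_invg_mul invgK (negPf nyx) mulr0.
Qed.

Fact gr_1neq0 : gr 1 != 0.
Proof.
apply/eqP => /ffunP/(_ 1%g); rewrite !ffunE eqxx => /eqP.
by rewrite oner_eq0.
Qed.

HB.instance Definition _ := GRing.Zmodule_isNzRing.Build kG
  gr_mulA gr_mul1 gr_mulr1 gr_mulDl gr_mulDr gr_1neq0.

Fact gr_scaleAl (c : k) (a b : kG) : c *: (a * b) = (c *: a) * b.
Proof.
apply/ffunP => x; rewrite !ffunE scaler_sumr; apply: eq_bigr => y _.
by rewrite ffunE scalerAl.
Qed.

HB.instance Definition _ := GRing.Lmodule_isLalgebra.Build k kG gr_scaleAl.

Fact gr_scaleAr (c : k) (a b : kG) : c *: (a * b) = a * (c *: b).
Proof.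
apply/ffunP => x; rewrite !ffunE scaler_sumr; apply: eq_bigr => y _.
by rewrite ffunE scalerAr.
Qed.

HB.instance Definition _ := GRing.Lalgebra_isAlgebra.Build k kG gr_scaleAr.
HB.instance Definition _ := Algebra_isFalgebra.Build k kG.

Lemma gr1 : gr 1 = 1. Proof. by []. Qed.

Lemma grM g h : gr (g * h) = gr g * gr h.
Proof.
apply/ffunP => x; rewrite !ffunE (bigD1 g) //= big1 => [|y nyg].
  by rewrite !ffunE eqxx mul1r addr0 (canF_eq (mulKVg g)).
by rewrite ffunE (negPf nyg) mul0r.
Qed.

Lemma gr_sum (a : kG) : a = \sum_g a g *: gr g.
Proof.
apply/ffunP => x; rewrite sum_ffunE (bigD1 x) //= big1 => [|y nyx].
  by rewrite !ffunE eqxx addr0 [RHS]mulr1.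
by rewrite !ffunE eq_sym (negPf nyx) scaler0.
Qed.

(* The antipode g |-> g^-1. *)
Definition gr_inv (a : kG) : kG := [ffun g => a g^-1%g].

Lemma gr_inv_linear : linear gr_inv.
Proof. by move=> c a b; apply/ffunP => x; rewrite !ffunE. Qed.

Lemma gr_inv_gr g : gr_inv (gr g) = gr g^-1.
Proof. by apply/ffunP => x; rewrite !ffunE -eq_invg_sym. Qed.

Lemma gr_invM a b : gr_inv (a * b) = gr_inv b * gr_inv a.
Proof.
apply/ffunP => x; rewrite !ffunE (reindex_inj (mulgI x^-1%g)) /=.
by apply: eq_bigr => y _; rewrite !ffunE !invMg !invgK mulgK mulrC.
Qed.
End GroupAlgebra.
Arguments gr {k gT} g%_g.

(* The dual V^* of a left kG-module, with (g f)(t) = f(g^-1 t). *)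
Section Dual.
Variables (k : fieldType) (gT : finGroupType) (V : lmodule (gralg k gT)).
Local Notation V' := 'Hom(V, k^o).

Definition precomp (h : 'End(V)) (f : V') : V' := (f \o h)%VF.

Fact precomp_linear h : linear (precomp h).
Proof. by move=> c f f'; rewrite /precomp comp_lfunDl comp_lfunZl. Qed.
HB.instance Definition _ h :=
  GRing.isLinear.Build k V' V' _ (precomp h) (precomp_linear h).

Definition dual_act (a : gralg k gT) : 'End(V') :=
  linfun (precomp (mod_act V (gr_inv a))).

Fact dual_act_linear : linear dual_act.
Proof.
move=> c a b; apply/lfunP => f; apply/lfunP => t.
rewrite [in RHS]add_lfunE scale_lfunE !lfunE /= /precomp gr_inv_linear.
by rewrite linearP /= !add_lfunE !scale_lfunE !comp_lfunE linearP.
Qed.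

Fact dual_act1 : dual_act 1 = \1%VF.
Proof.
apply/lfunP => f; rewrite !lfunE /= /precomp -gr1 gr_inv_gr invg1 gr1 mod_act1.
by rewrite comp_lfun1r.
Qed.

Fact dual_actM a b : dual_act (a * b) = (dual_act a \o dual_act b)%VF.
Proof.
apply/lfunP => f; rewrite comp_lfunE !lfunE /= /precomp gr_invM mod_actM.
by rewrite comp_lfunA.
Qed.

Definition dual : lmodule (gralg k gT) :=
  LModule dual_act_linear dual_act1 dual_actM.

Lemma dual_gr g (f : V') t :
  (mod_act dual (gr g) f : V') t = f (mod_act V (gr g^-1) t).
Proof. by rewrite /= lfunE /= /precomp gr_inv_gr comp_lfunE. Qed.
End Dual.

Definition symmetric_type (k : fieldType) (gT hT : finGroupType)
    (M : bimodule (gralg k hT) (gralg k gT)) : Prop :=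
  exists b : {biscalar M},
    [/\ forall h g m n,
          b (lact M (gr h) (ract M (gr g) m)) (lact M (gr h) (ract M (gr g) n))
          = b m n,
        forall m n, b m n = b n m
      & forall m, (forall n, b m n = 0) -> m = 0].

Section QuadraticForms.
Variables (k : fieldType) (V : vectType k).

Definition polar (Q : V -> k) (v w : V) : k := Q (v + w) - Q v - Q w.

Definition quadratic_form (Q : V -> k) : Prop :=
  (forall c v, Q (c *: v) = c ^+ 2 * Q v) /\ bilinear_for *%R *%R (polar Q).

Definition nondegenerate_form (Q : V -> k) : Prop :=
  forall v, (forall w, polar Q v w = 0) -> Q v = 0 -> v = 0.
End QuadraticForms.

Definition quadratic_type (k : fieldType) (gT : finGroupType)
    (T : lmodule (gralg k gT)) : Prop :=
  iso_mod T (dual T) /\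
  exists Q : T -> k,
    [/\ quadratic_form Q, nondegenerate_form Q
      & forall g t, Q (mod_act T (gr g) t) = Q t].

(* Main.v *)
(* Projectivity enters only through Higman's criterion: the identity of a     *)
(* projective kG-module is a trace sum_g g a g^-1.                            *)
(* Over such modules in characteristic 2, being of quadratic type amounts to  *)
(* having a non-degenerate invariant symmetric form. A symmetric form B has   *)
(* B(x, x) = phi(x)^2 with phi linear, B + phi phi is alternating, of radical *)
(* at most a line on which phi does not vanish, and an alternating invariant  *)
(* form is the polarisation of an invariant quadratic form. Conversely the    *)
(* radical of the polarisation of Q is at most a line of fixed vectors; it is *)
(* zero if |G| is even, and otherwise split off by averaging a functional.    *)
(* Finally forms b on M and B on P give the invariant symmetric form          *)
(*   S(m (x) p, n (x) q) = sum_g b(m g, n) B(g^-1 p, q)                       *)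
(* on M (x) P, whose non-degeneracy follows from Higman's criterion for the   *)
(* right kG-module M.                                                         *)

From HB Require Import structures.
Require Import Defs.
From mathcomp Require Import all_boot all_fingroup all_algebra falgebra.
From mathcomp Require Import pgroup ring.
Import GRing.Theory.
Local Open Scope ring_scope.

Set Implicit Arguments.
Unset Strict Implicit.
Unset Printing Implicit Defensive.

(* action.v also exports a constant named ract. *)
Local Notation ract := Defs.ract.

(** Symmetric forms multiply under tensor products. So the quadratic form on [P] is traded for a
    symmetric one ([quadratic_type_symmetric]), which is combined with the form on [M]
    ([tensor_symmetric_nondegenerate]) and traded back on the tensor product
    ([symmetric_quadratic_type]). Since the group order may vanish in [k], averaging is replaced by
    the trace decomposition of the identity of a projective module ([projective_trace]). It turns an
    invariant alternating form into the polarisation of an invariant quadratic form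
    ([invariant_quadratic_form]), rules out a degenerate polarisation when |G| is even, and, for [M]
    as a right module, recovers an element of M (x) P from its pairings. For [M] as a left module it
    passes to the tensor product ([tensor_identity_is_trace]), which gives projectivity and the way
    back. *)

Lemma linear_lfun (k : fieldType) (U V : vectType k) (f : U -> V) :
  linear f -> exists F : 'Hom(U, V), forall u, F u = f u.
Proof.
move=> f_lin.
pose L := HB.pack_for {linear U -> V} f (GRing.isLinear.Build _ _ _ _ f f_lin).
by exists (linfun L) => u; rewrite lfunE.
Qed.

(** Forms are kept as linear maps into the dual, so that non-degeneracy is injectivity. *)
Lemma bilinear_lfun (k : fieldType) (U V W : vectType k) (f : U -> V -> W) :
  (forall v, linear (f^~ v)) -> (forall u, linear (f u)) ->
  exists F : 'Hom(U, 'Hom(V, W)), forall u v, F u v = f u v.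
Proof.
move=> fl fr; pose h u := sval (boolp.cid (linear_lfun (fr u))).
have hE u v : h u v = f u v by rewrite /h; case: boolp.cid.
have [|F FE] := @linear_lfun _ _ _ h; last by exists F => u v; rewrite FE hE.
by move=> c u u'; apply/lfunP => v; rewrite add_lfunE scale_lfunE !hE fl.
Qed.

Lemma closed_sqr_surj (k : closedFieldType) (a : k) : exists x, x ^+ 2 = a.
Proof.
(* With coefficients [a] and 0 the monic equation of degree 2 reads x^2 = a. *)
have [x] := @solve_monicpoly k 2%N (nth 0 [:: a]) isT.
rewrite !big_ord_recl big_ord0 /= mul0r !addr0 mulr1 => xa.
by exists x; exact: xa.
Qed.

(** * Bilinear and quadratic forms over a field *)

Section BilinearForms.
Variables (k : fieldType) (V : vectType k).
Implicit Types (B : 'Hom(V, 'Hom(V, k^o))).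

Lemma form_linearl B c x y z : B (c *: x + y) z = c * B x z + B y z :> k.
Proof. by rewrite linearP add_lfunE scale_lfunE. Qed.

Lemma form_linearr B c x y z : B z (c *: x + y) = c * B z x + B z y :> k.
Proof. exact: (linearP (B z)). Qed.

(** An injective linear map from [V] to its dual is onto, the dimensions being equal. *)
Lemma nondegenerate_surj B :
  (forall x, (forall y, B x y = 0) -> x = 0) ->
  forall f : 'Hom(V, k^o), exists w, forall y, B w y = f y.
Proof.
move=> Bnd f; have kB : (lker B == 0)%VS.
  rewrite -subv0; apply/subvP => x; rewrite memv_ker memv0 => /eqP Bx.
  by apply/eqP/Bnd => y; rewrite Bx zero_lfunE.
have : f \in limg B.
  suff -> : limg B = fullv by rewrite memvf.
  apply/eqP; rewrite eqEdim subvf limg_dim_eq ?(eqP kB) ?capv0 // !dimvf /=.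
  by rewrite /dim /= muln1.
by case/memv_imgP => w _ ->; exists w.
Qed.

Lemma linear_functional_nonzero (w : V) :
  w != 0 -> exists f : 'Hom(V, k^o), f w = 1.
Proof.
move=> w0; have [f fE] : exists f : 'Hom(V, k^o),
    forall v, f v = coord [tuple w] ord0 v.
  by apply: (@linear_lfun k V k^o) => c u v; rewrite linearP.
by exists f; rewrite fE (coord_free 0) ?seq1_free // eqxx.
Qed.

(** [Q] uses only the Gram matrix strictly above the diagonal, which avoids dividing by 2;
    polarising restores the lower half by symmetry, and the diagonal is zero. *)
Lemma alternating_polar B :
  (forall x y, B x y = B y x) -> (forall x, B x x = 0) ->
  exists Q : V -> k, quadratic_form Q /\ forall x y, polar Q x y = B x y.
Proof.
move=> Bsym Balt; pose n := \dim {:V}; pose e := vbasis {:V}.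
pose c i x := coord e i x.
pose Q x := \sum_(i < n) \sum_(j < n | (i < j)%N) c i x * c j x * B e`_i e`_j.
have polQ x y : polar Q x y = B x y.
  have BE : B x y = \sum_(i < n) \sum_(j < n) c i x * c j y * B e`_i e`_j.
    rewrite {1}(coord_vbasis (memvf x)) linear_sum sum_lfunE.
    apply: eq_bigr => i _; rewrite linearZ scale_lfunE /=.
    rewrite {1}(coord_vbasis (memvf y)) linear_sum scaler_sumr.
    by apply: eq_bigr => j _; rewrite linearZ scalerA.
  have -> : B x y = \sum_(i < n) \sum_(j < n | (i < j)%N)
      (c i x * c j y + c j x * c i y) * B e`_i e`_j.
    under [RHS]eq_bigr => i _ do (under eq_bigr => j _ do rewrite mulrDl;
      rewrite big_split).
    rewrite big_split /=.
    rewrite [X in _ + X](exchange_big_dep xpredT) //= -big_split BE.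
    apply: eq_bigr => i _ /=; rewrite (bigID (fun j : 'I_n => i < j)%N) /=.
    congr (_ + _); rewrite (bigID (pred1 i)) /=.
    rewrite big1 ?add0r => [|j /andP[_ /eqP->]]; last by rewrite Balt mulr0.
    apply: eq_big => [j|j _]; last by rewrite Bsym.
    by rewrite -leqNgt ltn_neqAle andbC.
  rewrite /polar /Q -!sumrB; apply: eq_bigr => i _; rewrite -!sumrB.
  apply: eq_bigr => j _; rewrite /c !linearD /= -!mulrBl; congr (_ * _).
  by rewrite mulrDl !mulrDr; ring.
exists Q; split=> //; split=> [a x|].
  rewrite /Q mulr_sumr; apply: eq_bigr => i _; rewrite mulr_sumr.
  by apply: eq_bigr => j _; rewrite /c !linearZ /= !mulrA; congr (_ * _); ring.
by split=> x a y z; rewrite !polQ (form_linearl, form_linearr).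
Qed.
End BilinearForms.

Lemma gr_equivariant (k : fieldType) (gT : finGroupType)
    (V W : lmodule (gralg k gT)) (f : 'Hom(V, W)) :
  (forall g v, f (mod_act V (gr g) v) = mod_act W (gr g) (f v)) ->
  forall a v, f (mod_act V a v) = mod_act W a (f v).
Proof.
move=> fg a v; rewrite (gr_sum a) !linear_sum !sum_lfunE linear_sum.
by apply: eq_bigr => g _; rewrite !linearZ !scale_lfunE linearZ /= fg.
Qed.

(** * Invariant forms and traces *)

Section QuadraticType.
Variables (k : fieldType) (gT : finGroupType) (V : lmodule (gralg k gT)).
Implicit Types (B : 'Hom(V, 'Hom(V, k^o))) (g h : gT) (x y v w : V).

(** The condition of Higman's criterion for projectivity; [a] is only k-linear. *)
Definition identity_is_trace : Prop :=
  exists a : 'End(V), forall v,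
    \sum_g mod_act V (gr g) (a (mod_act V (gr g^-1) v)) = v.

Definition invariant_form B : Prop :=
  forall g x y, B (mod_act V (gr g) x) (mod_act V (gr g) y) = B x y.

Definition symmetric_nondegenerate B : Prop :=
  [/\ invariant_form B, forall x y, B x y = B y x
    & forall x, (forall y, B x y = 0) -> x = 0].

Lemma act_grM g h x :
  mod_act V (gr (g * h)) x = mod_act V (gr g) (mod_act V (gr h) x).
Proof. by rewrite grM mod_actM comp_lfunE. Qed.

Lemma act_gr1 x : mod_act V (gr 1) x = x.
Proof. by rewrite gr1 mod_act1 id_lfunE. Qed.

Lemma polarE (Q : V -> k) x y : Q (x + y) = Q x + Q y + polar Q x y.
Proof. by rewrite /polar; ring. Qed.

(** Invariance of [B] makes x |-> B(x, .) equivariant; this supplies the self-duality required by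
    quadratic type. *)
Lemma invariant_form_iso_dual B :
  invariant_form B -> (forall x, (forall y, B x y = 0) -> x = 0) ->
  iso_mod V (dual V).
Proof.
move=> Binv Bnd.
have BP a x : B (mod_act V a x) = mod_act (dual V) a (B x).
  move: a x; apply: (@gr_equivariant _ _ V (dual V)) => g x.
  apply/lfunP => y; rewrite [RHS](dual_gr g (B x)).
  by rewrite -[in RHS](Binv g) -act_grM mulgV act_gr1.
exists (@MHom _ _ V (dual V) B BP) => /=.
exists (B^-1)%VF => [x|f].
  rewrite lker0_lfunK // -subv0; apply/subvP => z.
  rewrite memv_ker memv0 => /eqP Bz.
  by apply/eqP/Bnd => y; rewrite Bz zero_lfunE.
have [w wE] := nondegenerate_surj Bnd f.
have -> : f = B w by apply/lfunP => y; rewrite wE.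
by rewrite limg_lfunVK // memv_img ?memvf.
Qed.

(* If Q0 has polar form B, then D_g(x) := Q0(g x) - Q0(x) is additive and a   *)
(* 1-cocycle in g; a trace decomposition of the identity makes it a           *)
(* coboundary, which is then used to correct Q0.                              *)
Lemma invariant_quadratic_form B :
    identity_is_trace -> invariant_form B ->
    (forall x y, B x y = B y x) -> (forall x, B x x = 0) ->
  exists Q : V -> k, [/\ quadratic_form Q, forall x y, polar Q x y = B x y
    & forall g x, Q (mod_act V (gr g) x) = Q x].
Proof.
move=> [a aE] Binv Bsym Balt.
have [Q0 [[Q0Z _] Q0B]] := alternating_polar Bsym Balt.
pose D g x := Q0 (mod_act V (gr g) x) - Q0 x.
have DD g x y : D g (x + y) = D g x + D g y.
  by rewrite /D linearD !polarE !Q0B Binv; ring.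
have DZ g c x : D g (c *: x) = c ^+ 2 * D g x.
  by rewrite /D linearZ /= !Q0Z mulrBr.
have D0 g : D g 0 = 0 by rewrite -(scale0r 0) DZ expr0n mul0r.
have Dsum g (F : gT -> V) : D g (\sum_h F h) = \sum_h D g (F h).
  exact: (big_morph (D g) (DD g) (D0 g)).
have DM g h x : D (g * h)%g x = D g (mod_act V (gr h) x) + D h x.
  by rewrite /D act_grM; ring.
pose p h x := mod_act V (gr h) (a (mod_act V (gr h^-1) x)).
(* The p(h, x) sum to x and satisfy p(gh, gx) = g p(h, x), so the cocycle rule gives m(gx) = m(x) -
   D_g(x). As [m] is additive, adding it to [Q0] keeps the polarisation. *)
pose m x := \sum_h D h^-1%g (p h x).
have mD x y : m (x + y) = m x + m y.
  rewrite /m -big_split; apply: eq_bigr => h _ /=.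
  by rewrite -DD /p !linearD.
have mZ c x : m (c *: x) = c ^+ 2 * m x.
  by rewrite /m mulr_sumr; apply: eq_bigr => h _; rewrite -DZ /p !linearZ.
have pM g h x : p (g * h)%g (mod_act V (gr g) x) = mod_act V (gr g) (p h x).
  by rewrite /p act_grM -[X in a X]act_grM invMg mulgKV.
have mg g x : m (mod_act V (gr g) x) = m x - D g x.
  rewrite -{3}(aE x) Dsum -sumrB /m (reindex_inj (mulgI g)) /=.
  apply: eq_bigr => h _; rewrite pM.
  rewrite -[in X in _ = X - _](mulgKV g h^-1%g) DM invMg.
  by rewrite -/(p h x); ring.
exists (fun x => Q0 x + m x).
have pol x y : polar (fun x => Q0 x + m x) x y = B x y.
  by rewrite -Q0B /polar mD; ring.
split=> // [|g x]; last by rewrite mg /D; ring.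
split=> [c x|]; first by rewrite Q0Z mZ mulrDr.
by split=> x c y z; rewrite !pol (form_linearl, form_linearr).
Qed.
End QuadraticType.

(** * Characteristic 2: quadratic type and symmetric forms *)

Section ClosedField.
Variables (k : closedFieldType) (char2 : 2%N \in [pchar k]).
Variables (gT : finGroupType) (V : lmodule (gralg k gT)).
Implicit Types (B : 'Hom(V, 'Hom(V, k^o))) (g h : gT) (x y v w : V).

Lemma addrr2 (x : k) : x + x = 0.
Proof. exact: addrr_pchar2. Qed.

Lemma sqr_inj : injective (fun x : k => x ^+ 2).
Proof.
by move=> x y /= /eqP; rewrite eqf_sqr (oppr_pchar2 char2) orbb => /eqP.
Qed.

Lemma sqrD2 (x y : k) : (x + y) ^+ 2 = x ^+ 2 + y ^+ 2.
Proof. by rewrite sqrrD mulr2n addrr2 addr0. Qed.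

(** The square root [f] of B(x, x) is linear because squaring is additive and injective. Since f^2
    is invariant with zero polarisation, a multiple of it can be added to an invariant quadratic
    form with polarisation B + f f to make it non-degenerate. *)
Lemma symmetric_quadratic_type B :
  identity_is_trace V -> symmetric_nondegenerate B -> quadratic_type V.
Proof.
move=> trV [Binv Bsym Bnd]; split; first exact: invariant_form_iso_dual Bnd.
pose f x : k := sval (boolp.cid (closed_sqr_surj (B x x))).
have fE x : f x ^+ 2 = B x x by rewrite /f; case: boolp.cid.
have f_lin c x y : f (c *: x + y) = c * f x + f y.
  apply: sqr_inj; rewrite sqrD2 exprMn !fE.
  rewrite form_linearl !form_linearr (Bsym y x).
  by rewrite -[RHS]addr0 -(addrr2 (c * B x y)); ring.
have fg g x : f (mod_act V (gr g) x) = f x.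
  by apply: sqr_inj; rewrite !fE Binv.
have [phi phiE] := @linear_lfun k V k^o f f_lin.
have [w wE] := nondegenerate_surj Bnd phi.
have fZ c x : f (c *: x) = c * f x by rewrite -!phiE linearZ.
have fD x y : f (x + y) = f x + f y by rewrite -!phiE linearD.
have [|x|B1 B1E] := @bilinear_lfun k V V k^o (fun x y => B x y + f x * f y).
- move=> y c x x'; rewrite form_linearl f_lin.
  by rewrite /GRing.scale /=; ring.
- move=> c y y'; rewrite form_linearr f_lin.
  by rewrite /GRing.scale /=; ring.
have [|x y|x|Q1 [[Q1Z _] Q1B Q1inv]] := @invariant_quadratic_form _ _ V B1 trV.
- by move=> g x y; rewrite !B1E Binv !fg.
- by rewrite !B1E Bsym mulrC.
- by rewrite B1E -fE addrr2.
(* This gives Q(w) = 1 when f(w) = 1, the case where [w] lies in the radical of [B1]. *)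
pose c := 1 - Q1 w.
pose Q x := Q1 x + c * f x ^+ 2.
have QB x y : polar Q x y = B1 x y.
  by rewrite -Q1B /polar /Q fD sqrD2; ring.
exists Q; split=> [||g x]; last by rewrite /Q Q1inv fg.
  split=> [a x|]; first by rewrite /Q Q1Z fZ; ring.
  by split=> x a y z; rewrite !QB (form_linearl, form_linearr).
move=> x xrad Qx.
(* On the radical of [B1], B(x, y) = -f(x) f(y) = B(-f(x) w, y). *)
have xE : x = - f x *: w.
  apply/eqP; rewrite scaleNr -addr_eq0; apply/eqP/Bnd => y.
  rewrite addrC form_linearl wE phiE addrC.
  by rewrite -[RHS](xrad y) QB B1E.
suff fx0 : f x = 0 by rewrite xE fx0 oppr0 scale0r.
have fw : f w = 0 \/ f w = 1.
  have /eqP : f w * (f w - 1) = 0.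
    by rewrite mulrBr mulr1 -expr2 fE wE phiE subrr.
  by rewrite mulf_eq0 subr_eq0 => /orP[] /eqP; [left | right].
case: fw => fw; first by rewrite xE fZ fw mulr0.
have Qw : Q w = 1 by rewrite /Q fw expr1n mulr1 /c addrC subrK.
have : Q x = f x ^+ 2.
  by rewrite {1}xE /Q Q1Z fZ -[RHS]mulr1 -Qw /Q; ring.
by rewrite Qx => /esym/eqP; rewrite sqrf_eq0 => /eqP.
Qed.

(** Left multiplication by [t] pairs the group elements without fixed points; [A] takes from each
    pair the one of smaller [enum_rank]. *)
Lemma involution_halving (F : gT -> V) (t : gT) : t != 1%g -> (t * t = 1)%g ->
  exists A : {set gT}, \sum_g F g = \sum_(g in A) (F g + F (t * g)%g).
Proof.
move=> t1 tt; pose A := [set g | (enum_rank g < enum_rank (t * g)%g)%N].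
exists A.
rewrite big_split /= (bigID (mem A)) /=.
congr (_ + _); rewrite (reindex_inj (mulgI t)) /=.
apply: eq_bigl => g; rewrite !inE mulgA tt mul1g -leqNgt leq_eqVlt orbC.
case: ltngtP => //= /ord_inj/enum_rank_inj/eqP.
by rewrite -{1}(mul1g g) (inj_eq (mulIg g)) eq_sym (negPf t1).
Qed.

(** On the radical of the polarisation [Q] is additive, scales by squares and vanishes only at 0, so
    the radical is at most a line. A spanning vector [w] is fixed and forces odd order; adding
    lam(x) lam(y), for an invariant functional [lam] with lam(w) = 1, then removes the radical. *)
Lemma quadratic_type_symmetric :
  identity_is_trace V -> quadratic_type V ->
  exists B, symmetric_nondegenerate B.
Proof.
move=> [a aE] [_ [Q [[QZ Qbil] Qnd Qinv]]].
have [|x|B BE] := @bilinear_lfun k V V k^o (polar Q).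
- by move=> y c x x'; rewrite Qbil.1.
- by move=> c y y'; rewrite Qbil.2.
have Bsym x y : B x y = B y x by rewrite !BE /polar [y + x]addrC; ring.
have Binv g x y : B (mod_act V (gr g) x) (mod_act V (gr g) y) = B x y.
  by rewrite !BE /polar -linearD !Qinv.
have Balt x : B x x = 0.
  have -> : B x x = 2%:R * Q x.
    by rewrite BE /polar -mulr2n -scaler_nat QZ; ring.
  by rewrite (pcharf0 char2) mul0r.
have [[w w0 wrad]|noradB] :=
  boolp.pselect (exists2 w, w != 0 & forall y, B w y = 0); last first.
  exists B; split=> // x xrad; apply/eqP/negPn/negP => x0.
  by apply: noradB; exists x.
have Qw : Q w != 0.
  by apply: contra_neq w0 => Qw; apply: Qnd Qw => y; rewrite -BE.
have radE x : (forall y, B x y = 0) -> exists c, x = c *: w.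
  move=> xrad; have [c cE] := closed_sqr_surj (Q x / Q w).
  exists c; apply/eqP; rewrite -subr_eq0; apply/eqP/Qnd => [y|].
    rewrite -BE linearB linearZ add_lfunE opp_lfunE scale_lfunE xrad wrad.
    by rewrite scaler0 subr0.
  rewrite polarE -scaleNr QZ sqrrN cE divfK // -BE xrad addr0.
  exact: addrr2.
have wfix g : mod_act V (gr g) w = w.
  have [c cE] : exists c, mod_act V (gr g) w = c *: w.
    apply: radE => y; rewrite -[y](act_gr1 (V := V)) -(mulgV g) act_grM Binv.
    exact: wrad.
  rewrite cE; suff -> : c = 1 by rewrite scale1r.
  by apply: sqr_inj; apply: (mulIf Qw); rewrite -QZ -cE Qinv expr1n mul1r.
have oddG : odd #|gT|.
  (* For an involution t, w = z + t z gives Q(w) = B(z, t z) = B(z, w) = 0. *)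
  apply: contraT; rewrite -dvdn2 -cardsT => even.
  have [t _ ot] := @Cauchy _ 2 [set: gT] isT even.
  have t1 : t != 1%g by rewrite -order_eq1 ot.
  have tt : (t * t = 1)%g by rewrite -expg2 -ot expg_order.
  have [A sumA] := involution_halving
    (fun g => mod_act V (gr g) (a (mod_act V (gr g^-1) w))) t1 tt.
  pose z := \sum_(g in A) mod_act V (gr g) (a w).
  have wE : w = z + mod_act V (gr t) z.
    rewrite -[LHS]aE sumA linear_sum -big_split /=.
    by apply: eq_bigr => g _; rewrite !wfix act_grM.
  move: Qw; rewrite {1}wE polarE Qinv addrr2 add0r -BE.
  have -> : mod_act V (gr t) z = w - z by rewrite wE addrAC subrr add0r.
  by rewrite linearB /= Balt subr0 Bsym wrad eqxx.
have [mu mu_w] : exists mu : 'Hom(V, k^o), mu w = 1.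
  exact: linear_functional_nonzero.
pose lam x : k := \sum_g (mu (mod_act V (gr g) x) : k).
have lam_lin c x y : lam (c *: x + y) = c * lam x + lam y.
  rewrite /lam mulr_sumr -big_split; apply: eq_bigr => g _ /=.
  by rewrite !linearP.
have lam_g g x : lam (mod_act V (gr g) x) = lam x.
  rewrite /lam [RHS](reindex_inj (mulIg g)); apply: eq_bigr => h _.
  by rewrite act_grM.
have lam_w : lam w = 1.
  rewrite /lam; under eq_bigr => g _ do rewrite wfix mu_w.
  rewrite sumr_const -(odd_double_half #|gT|) oddG mulrnDr -mul2n mulrnA.
  by rewrite (pcharf0 char2) mul0rn addr0.
have [||B2 B2E] := @bilinear_lfun k V V k^o (fun x y => B x y + lam x * lam y).
- move=> y c x x'; rewrite form_linearl lam_lin.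
  by rewrite /GRing.scale /=; ring.
- move=> x c y y'; rewrite form_linearr lam_lin.
  by rewrite /GRing.scale /=; ring.
exists B2; split=> [g x y|x y|x xrad].
- by rewrite !B2E Binv !lam_g.
- by rewrite !B2E Bsym mulrC.
(* Pairing with [w] gives lam(x) = 0, so x lies in the old radical k w, on which [lam] is
   injective. *)
have lamx : lam x = 0.
  by have := xrad w; rewrite B2E Bsym wrad lam_w mulr1 add0r.
have [|c xE] := radE x.
  by move=> y; have := xrad y; rewrite B2E lamx mul0r addr0.
suff c0 : c = 0 by rewrite xE c0 scale0r.
have := lam_lin c w 0; rewrite addr0 -xE lamx lam_w mulr1.
have -> : lam 0 = 0 by rewrite /lam big1 // => g _; rewrite !linear0.
by rewrite addr0.
Qed.
End ClosedField.

(** * Higman's criterion over an algebra or its opposite *)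

Section ConverseFalgebra.
Import VectorInternalTheory.
Variables (k : fieldType) (A : falgType k).

(** Makes [A^c] a [falgType], so that [projective_trace] also covers right modules. *)
Fact converse_vector_axiom : Vector.axiom (dim A) A^c.
Proof.
have v2r_linear : linear (@v2r k A) by move=> c x y; exact: linearP.
exists (@v2r k A) => [c x y|]; first exact: (v2r_linear c (x : A) y).
exact: Bijective (@v2rK _ A) (@r2vK _ A).
Qed.
HB.instance Definition _ :=
  Lmodule_hasFinDim.Build k A^c converse_vector_axiom.
End ConverseFalgebra.

Section Higman.
Variables (k : fieldType) (A : falgType k) (e : A).
Variables (I : finType) (u u' : I -> A) (lam : 'Hom(A, k^o)).
Hypotheses (ee : e * e = e) (eC : forall x, x * e = e * x).
(** The Casimir identity sum_i u_i (x) u'_i x = sum_i x u_i (x) u'_i, tested against linear maps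
    into modules. For a group algebra u_i = g, u'_i = g^-1, and [lam] is the coefficient at 1. *)
Hypothesis casimir : forall (V : lmodule A) (F : 'Hom(A, V)) x,
  \sum_i mod_act V (u i) (F (u' i * x)) = \sum_i mod_act V (x * u i) (F (u' i)).
Hypothesis lam1 : \sum_i lam (u' i) *: u i = 1.

(* The module coinduced from P, that is Hom_k(Ae, P), maps onto P by          *)
(* f |-> sum_i u_i f(u'_i e), and a section of this map provides a.           *)
Lemma projective_trace (P : fmod e) : projective P ->
  exists a : 'End(P), forall v,
    \sum_i mod_act P (u i) (a (mod_act P (u' i) v)) = v.
Proof.
move=> projP; pose U : {vspace A} := limg (amulr e).
have UP x : (x \in U) = (x * e == x).
  apply/memv_imgP/eqP => [[y _ ->]|xe]; last first.
    by exists x; rewrite ?memvf // lfunE.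
  by rewrite !lfunE /= -mulrA ee.
have Ue x : x * e \in U by rewrite UP -mulrA ee.
have [j vj] : exists j : 'Hom(A, subvs_of U), forall x, vsval (j x) = x * e.
  exists (linfun (vsproj U) \o amulr e)%VF => x.
  by rewrite comp_lfunE !lfunE /= vsprojK.
have vinj (x y : subvs_of U) : vsval x = vsval y -> x = y by move/val_inj.
have jval (x : subvs_of U) : j (vsval x) = x.
  by apply: vinj; rewrite vj; apply/eqP; rewrite -UP subvsP.
have [r rj] : exists r : A -> 'End(subvs_of U),
    forall a x, r a (j x) = j (x * a).
  exists (fun a => j \o amulr a \o linfun vsval)%VF => a x.
  apply: vinj; rewrite !comp_lfunE !vj [amulr a _]lfunE [linfun vsval _]lfunE.
  by rewrite /= vj -!mulrA (eC a) [e * (e * a)]mulrA ee.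
(* The action on the coinduced module is (a f)(x) = f(xa). *)
have [f c a b|a c f g|R RE] := @bilinear_lfun k A 'Hom(subvs_of U, P)
    'Hom(subvs_of U, P) (fun a f => f \o r a)%VF.
- apply/lfunP => x; rewrite add_lfunE scale_lfunE !comp_lfunE -(jval x) !rj.
  by rewrite mulrDr -scalerAr !linearP.
- by rewrite comp_lfunDl comp_lfunZl.
have R1 : R 1 = \1%VF.
  apply/lfunP => f; rewrite RE id_lfunE; apply/lfunP => x.
  by rewrite comp_lfunE -(jval x) rj mulr1.
have RM a b : R (a * b) = (R a \o R b)%VF.
  apply/lfunP => f; rewrite comp_lfunE !RE; apply/lfunP => x.
  by rewrite !comp_lfunE -(jval x) !rj mulrA.
have Rlin : linear R by move=> c a b; rewrite linearP.
have Re : R e = \1%VF.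
  apply/lfunP => f; rewrite RE id_lfunE; apply/lfunP => x.
  rewrite comp_lfunE -(jval x) rj; congr (f _); apply: vinj.
  by rewrite !vj -mulrA ee.
pose X : fmod e := @FMod _ _ e (LModule Rlin R1 RM) Re.
have [p pE] : exists p : 'Hom(X, P),
    forall f : X, p f = \sum_i mod_act P (u i) ((f : 'Hom(_, P)) (j (u' i))).
  apply: linear_lfun => c f g; rewrite scaler_sumr -big_split.
  by apply: eq_bigr => i _ /=; rewrite add_lfunE scale_lfunE linearP.
have pP a (f : X) : p (mod_act X a f) = mod_act P a (p f).
  rewrite !pE linear_sum /= RE.
  under eq_bigr => i _ do rewrite comp_lfunE rj -(comp_lfunE _ j).
  rewrite casimir; apply: eq_bigr => i _.
  by rewrite mod_actM !comp_lfunE.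
have psurj : limg p = fullv.
  apply/eqP; rewrite eqEsubv subvf; apply/subvP => v _.
  (* A preimage of v: sum_i lam(u'_i e) u_i v = e (sum_i lam(u'_i) u_i) v = e v = v. *)
  have [f fE] : exists f : X, forall x, (f : 'Hom(_, P)) x = lam (vsval x) *: v.
    by apply: linear_lfun => c x y; rewrite !linearP scalerDl scalerA.
  have [F FE] : exists F : 'Hom(A, P), forall x, F x = lam x *: v.
    by apply: linear_lfun => c x y; rewrite !linearP scalerDl scalerA.
  apply/memv_imgP; exists f; rewrite ?memvf // pE.
  under eq_bigr => i _ do rewrite fE vj -FE.
  have actF i : mod_act P (e * u i) (F (u' i))
      = mod_act P (e * (lam (u' i) *: u i)) v.
    by rewrite FE -scalerAr !linearZ /= scale_lfunE.
  rewrite casimir (eq_bigr _ (fun i _ => actF i)).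
  rewrite -sum_lfunE -linear_sum -mulr_sumr lam1 mulr1 /=.
  by rewrite [mod_act P e]fmodP id_lfunE.
have [g gE] := projP X P (MHom pP) (mhom_id P) psurj.
(* [a] evaluates the section at e = [j 1]; equivariance turns a(u'_i v) into g(v)(u'_i e). *)
have [a aE] : exists a : 'End(P), forall v, a v = (g v : 'Hom(_, P)) (j 1).
  apply: linear_lfun => c x y; rewrite linearP.
  by rewrite [LHS]add_lfunE [X in X + _]scale_lfunE.
exists a => v; rewrite -[RHS](id_lfunE v) -[RHS]gE /= pE.
apply: eq_bigr => i _; congr (mod_act P _ _).
by rewrite aE mhomP /= RE comp_lfunE rj mul1r.
Qed.
End Higman.

(** With e the identity of [B], both xe and ex lie in [B], so both equal exe. *)
Lemma ideal_algid_central (k : fieldType) (A : falgType k) (B : {aspace A}) :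
  ideal B -> forall x, x * algid B = algid B * x.
Proof.
case=> /subvP lB /subvP rB x; have eB := memv_algid B.
have xe : x * algid B \in B by apply: lB; rewrite memv_mul ?memvf.
have ex : algid B * x \in B by apply: rB; rewrite memv_mul ?memvf.
by rewrite -(algidl xe) -[RHS](algidr ex) mulrA.
Qed.

(** * Projective modules over group algebras *)

Section GroupAlgebraProjective.
Variables (k : fieldType) (gT : finGroupType).

(** Both sides are linear in x, and for x = h the substitution g -> hg matches them. *)
Lemma gr_casimir (V : vectType k) (act : 'Hom(gralg k gT, 'End(V)))
    (F : 'Hom(gralg k gT, V)) x :
  \sum_g act (gr g) (F (gr g^-1 * x)) = \sum_g act (x * gr g) (F (gr g^-1)).
Proof.
have L g : act (gr g) (F (gr g^-1 * x))
    = \sum_h x h *: act (gr g) (F (gr (g^-1 * h))).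
  rewrite [in LHS](gr_sum x) mulr_sumr !linear_sum; apply: eq_bigr => h _.
  by rewrite -scalerAr -grM !linearZ.
have R g : act (x * gr g) (F (gr g^-1))
    = \sum_h x h *: act (gr (h * g)) (F (gr g^-1)).
  rewrite [in LHS](gr_sum x) mulr_suml linear_sum sum_lfunE.
  by apply: eq_bigr => h _; rewrite -scalerAl -grM linearZ scale_lfunE.
under eq_bigr do rewrite L; under [RHS]eq_bigr do rewrite R.
rewrite exchange_big [RHS]exchange_big; apply: eq_bigr => h _ /=.
rewrite [LHS](reindex_inj (mulgI h)) /=; apply: eq_bigr => g _.
by rewrite invMg mulgKV.
Qed.

(** The Casimir identity for the opposite product, by g -> gh; it serves right modules. *)
Lemma gr_casimir_converse (V : vectType k) (act : 'Hom(gralg k gT, 'End(V)))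
    (F : 'Hom(gralg k gT, V)) x :
  \sum_g act (gr g) (F (x * gr g^-1)) = \sum_g act (gr g * x) (F (gr g^-1)).
Proof.
have L g : act (gr g) (F (x * gr g^-1))
    = \sum_h x h *: act (gr g) (F (gr (h * g^-1))).
  rewrite [in LHS](gr_sum x) mulr_suml !linear_sum; apply: eq_bigr => h _.
  by rewrite -scalerAl -grM !linearZ.
have R g : act (gr g * x) (F (gr g^-1))
    = \sum_h x h *: act (gr (g * h)) (F (gr g^-1)).
  rewrite [in LHS](gr_sum x) mulr_sumr linear_sum sum_lfunE.
  by apply: eq_bigr => h _; rewrite -scalerAr -grM linearZ scale_lfunE.
under eq_bigr do rewrite L; under [RHS]eq_bigr do rewrite R.
rewrite exchange_big [RHS]exchange_big; apply: eq_bigr => h _ /=.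
rewrite [LHS](reindex_inj (mulIg h)) /=; apply: eq_bigr => g _.
by rewrite invMg mulKVg.
Qed.

Lemma gr_counit : exists lam : 'Hom(gralg k gT, k^o),
  \sum_g lam (gr g^-1) *: gr g = 1.
Proof.
have [lam lamE] : exists lam : 'Hom(gralg k gT, k^o), forall a, lam a = a 1%g.
  by apply: linear_lfun => c a b; rewrite !ffunE.
exists lam; rewrite (bigD1 1%g) //= big1 => [|g g1]; rewrite lamE ffunE.
  by rewrite invg1 eqxx scale1r addr0.
by rewrite eq_sym invg_eq1 (negPf g1) scale0r.
Qed.

Variables (B : {aspace gralg k gT}).
Hypothesis idealB : ideal B.

Lemma projective_identity_is_trace (P : fmod (algid B)) :
  projective P -> identity_is_trace P.
Proof.
have [lam lam1] := gr_counit.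
apply: (projective_trace (algidl (memv_algid B))
  (ideal_algid_central idealB) _ lam1).
move=> V F x; have [act actE] := linear_lfun (mod_act_linear V).
have := gr_casimir act F x.
by under eq_bigr do rewrite actE; under [RHS]eq_bigr do rewrite actE.
Qed.

Lemma right_projective_trace (hT : finGroupType)
    (M : bimodule (gralg k hT) (gralg k gT))
    (eM : mod_act (rside M) (algid B) = \1%VF) :
  projective (FMod eM) ->
  exists a : 'End(M), forall m,
    \sum_g ract M (gr g) (a (ract M (gr g^-1) m)) = m.
Proof.
have [lam lam1] := gr_counit.
have cas (V : lmodule (gralg k gT)^c) (F : 'Hom((gralg k gT)^c, V))
    (x : (gralg k gT)^c) :
    \sum_g mod_act V (gr g : gralg k gT) (F ((gr g^-1 : (gralg k gT)^c) * x))
    = \sum_g mod_act V (x * (gr g : (gralg k gT)^c)) (F (gr g^-1 : gralg k gT)).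
  have [act actE] : exists act : 'Hom(gralg k gT, 'End(V)),
      forall a, act a = mod_act V a.
    by apply: linear_lfun => c a b; apply: (mod_act_linear V).
  have [G GE] : exists G : 'Hom(gralg k gT, V), forall a, G a = F a.
    by apply: linear_lfun => c a b; apply: (linearP F).
  have := gr_casimir_converse act G x.
  under eq_bigr do rewrite actE GE.
  by under [X in _ = X -> _]eq_bigr do rewrite actE GE.
have [lam' lamE] : exists lam' : 'Hom((gralg k gT)^c, k^o),
    forall a, lam' a = lam a.
  by apply: linear_lfun => c a b; apply: (linearP lam).
apply: (@projective_trace k (gralg k gT)^c (algid B) gT _ _ lam' _ _ cas).
- exact: (algidl (memv_algid B)).
- by move=> x; rewrite -[LHS](ideal_algid_central idealB).
- by under eq_bigr do rewrite lamE.
Qed.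

(** A k-linear lift of [f] through [p], composed with [a] and summed over conjugates, becomes
    equivariant and still lifts [f]. *)
Lemma identity_is_trace_projective (P : fmod (algid B)) :
  identity_is_trace P -> projective P.
Proof.
move=> [a aE] X Y p f psurj.
pose g : 'Hom(P, X) := (\sum_h (mod_act X (gr h) \o p^-1 \o f \o a
  \o mod_act P (gr h^-1)))%VF.
have gE v : g v =
    \sum_h mod_act X (gr h) (p^-1%VF (f (a (mod_act P (gr h^-1) v)))).
  by rewrite sum_lfunE; apply: eq_bigr => h _; rewrite !comp_lfunE.
have gP b v : g (mod_act P b v) = mod_act X b (g v).
  move: b v; apply: gr_equivariant => h v.
  rewrite !gE linear_sum (reindex_inj (mulgI h)) /=.
  by apply: eq_bigr => h' _; rewrite act_grM -[in a _]act_grM invMg mulgKV.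
exists (MHom gP) => v /=; rewrite gE linear_sum -[in RHS](aE v) linear_sum /=.
apply: eq_bigr => h _; rewrite !mhomP limg_lfunVK //.
by rewrite psurj memvf.
Qed.
End GroupAlgebraProjective.

(** * Traces and forms on the tensor product *)

Section TensorProductGroup.
Variables (k : fieldType) (gT hT : finGroupType).
Variables (M : bimodule (gralg k hT) (gralg k gT)) (V : lmodule (gralg k gT)).
Implicit Types (g x : gT) (h : hT) (m n : M) (v w : V).
Local Notation T := (tprod M V).

Lemma tprod_gr_lift (W : vectType k) (f : M -> V -> W) :
  (forall v, linear (f^~ v)) -> (forall m, linear (f m)) ->
  (forall g m v, f (ract M (gr g) m) v = f m (mod_act V (gr g) v)) ->
  exists F : 'Hom(T, W), forall m v, F (tpure m v) = f m v.
Proof.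
move=> fl fr fb.
pose L := HB.pack_for {bilinear M -> V -> W} f
  (bilinear_isBilinear.Build _ _ _ _ _ _ f (fl, fr)).
have [|F [FE _]] := @tprod_lift _ _ _ M V W L; last by exists F.
move=> a m v; rewrite -[LHS]/(f _ v) -[RHS]/(f m _).
have [G GE] := linear_lfun (fl v); have [G' GE'] := linear_lfun (fr m).
rewrite -GE -GE' (gr_sum a) !linear_sum !sum_lfunE !linear_sum.
apply: eq_bigr => g _; rewrite !linearZ !scale_lfunE !linearZ /=.
by rewrite GE GE' fb.
Qed.

Lemma tprod_linear_eq (W : vectType k) (f f' : T -> W) :
  linear f -> linear f' ->
  (forall m v, f (tpure m v) = f' (tpure m v)) -> f =1 f'.
Proof.
move=> /linear_lfun[F FE] /linear_lfun[F' FE'] ff z.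
by rewrite -FE -FE' (_ : F = F') //; apply: tprod_eq => m v; rewrite FE FE'.
Qed.

Lemma tpure_suml (I : finType) (f : I -> M) v :
  tpure (\sum_i f i) v = \sum_i tpure (f i) v :> T.
Proof.
have [F FE] := linear_lfun (@tpure_linearl _ _ _ M V v).
by rewrite -FE linear_sum; apply: eq_bigr => i _; apply: FE.
Qed.

Lemma tpure_sumr (I : finType) m (f : I -> V) :
  tpure m (\sum_i f i) = \sum_i tpure m (f i) :> T.
Proof.
have [F FE] := linear_lfun (@tpure_linearr _ _ _ M V m).
by rewrite -FE linear_sum; apply: eq_bigr => i _; apply: FE.
Qed.

Lemma tpureZl c m v : tpure (c *: m) v = c *: tpure m v :> T.
Proof.
have [F FE] := linear_lfun (@tpure_linearl _ _ _ M V v).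
by rewrite -!FE linearZ.
Qed.

Lemma tpureZr c m v : tpure m (c *: v) = c *: tpure m v :> T.
Proof.
have [F FE] := linear_lfun (@tpure_linearr _ _ _ M V m).
by rewrite -!FE linearZ.
Qed.

Lemma ract_grM g x m :
  ract M (gr (g * x)) m = ract M (gr x) (ract M (gr g) m).
Proof. by rewrite grM ractM comp_lfunE. Qed.

Lemma ract_gr1 m : ract M (gr 1) m = m.
Proof. by rewrite gr1 ract1 id_lfunE. Qed.

(** The balanced map m (x) v |-> sum_g a(mg) (x) b(g^-1 v) works: its trace over H turns a(mg) into
    mg, and moving g across leaves m (x) sum_g g b(g^-1 v) = m (x) v. *)
Lemma tensor_identity_is_trace :
  identity_is_trace (lside M) -> identity_is_trace V ->
  identity_is_trace (tensor M V).
Proof.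
move=> [a aE] [b bE].
have [v c m n|m c v w|g m v|F FE] := @tprod_gr_lift T (fun m v => \sum_g
  tpure (a (ract M (gr g) m)) (b (mod_act V (gr g^-1) v))).
- rewrite scaler_sumr -big_split; apply: eq_bigr => g _.
  by rewrite !linearP tpure_linearl.
- rewrite scaler_sumr -big_split; apply: eq_bigr => g _.
  by rewrite !linearP tpure_linearr.
- rewrite [RHS](reindex_inj (mulgI g)); apply: eq_bigr => x _ /=.
  rewrite ract_grM invMg act_grM -[X in _ = tpure _ (b (_ X))]act_grM.
  by rewrite mulVg act_gr1.
exists F => z; move: z.
apply: (@tprod_linear_eq T (fun z => \sum_h mod_act (tensor M V) (gr h)
   (F (mod_act (tensor M V) (gr h^-1) z))) id) => [c y z|//|m v].
  by rewrite scaler_sumr -big_split; apply: eq_bigr => h _; rewrite !linearP.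
have E h : mod_act (tensor M V) (gr h)
    (F (mod_act (tensor M V) (gr h^-1) (tpure m v)))
  = \sum_g tpure (lact M (gr h) (a (lact M (gr h^-1) (ract M (gr g) m))))
      (b (mod_act V (gr g^-1) v)).
  rewrite mod_act_tensor FE linear_sum; apply: eq_bigr => g _.
  by rewrite [LHS]mod_act_tensor lractC.
rewrite (eq_bigr _ (fun h _ => E h)).
rewrite exchange_big /= -[in RHS](bE v) tpure_sumr.
apply: eq_bigr => g _; rewrite -tpure_bal -[in RHS](aE (ract M (gr g) m)).
by rewrite tpure_suml.
Qed.

(** Contraction with n is the map F_n(m (x) v) = sum_g b(mg, n) g^-1 v, and S(z, n (x) w) =
    B(F_n(z), w). A radical vector z thus has F_n(z) = 0 for all n, while z can be rebuilt from the
    F_n(z). *)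
Lemma tensor_symmetric_nondegenerate (B : 'Hom(V, 'Hom(V, k^o))) :
  (exists a : 'End(M), forall m,
    \sum_g ract M (gr g) (a (ract M (gr g^-1) m)) = m) ->
  symmetric_type M -> symmetric_nondegenerate B ->
  exists S, @symmetric_nondegenerate _ _ (tensor M V) S.
Proof.
move=> [a aE] [b [binv bsym bnd]] [Binv Bsym Bnd].
have bg g m n : b (ract M (gr g) m) (ract M (gr g) n) = b m n.
  by have := binv 1%g g m n; rewrite !gr1 !lact1 !id_lfunE.
have bh h m n : b (lact M (gr h) m) (lact M (gr h) n) = b m n.
  by have := binv h 1%g m n; rewrite !gr1 !ract1 !id_lfunE.
have [n c m m'|m c n n'|bM bME] := @bilinear_lfun k M M k^o b.
- by rewrite linearPl.
- by rewrite linearPr.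
pose t n m v := \sum_g b (ract M (gr g) m) n *: mod_act V (gr g^-1) v.
have tP n : exists F : 'Hom(T, V), forall m v, F (tpure m v) = t n m v.
  apply: tprod_gr_lift => [v c m m'|m c v v'|g m v].
  - rewrite /t scaler_sumr -big_split; apply: eq_bigr => g _ /=.
    by rewrite -!bME [ract M _ _]linearP form_linearl scalerA -scalerDl.
  - rewrite /t scaler_sumr -big_split; apply: eq_bigr => g _ /=.
    by rewrite linearP scalerDr !scalerA mulrC.
  - rewrite /t [RHS](reindex_inj (mulgI g)) /=; apply: eq_bigr => x _.
    by rewrite ract_grM invMg act_grM -[in RHS](act_grM g^-1) mulVg act_gr1.
pose F n := sval (boolp.cid (tP n)).
have FE n m v : F n (tpure m v) = t n m v by rewrite /F; case: boolp.cid.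
have F_lin c n n' z : F (c *: n + n') z = c *: F n z + F n' z.
  rewrite -scale_lfunE -add_lfunE; congr (fun_of_lfun _ z).
  apply: tprod_eq => m v; rewrite add_lfunE scale_lfunE !FE /t.
  rewrite scaler_sumr -big_split; apply: eq_bigr => g _ /=.
  by rewrite -!bME form_linearr scalerA -scalerDl.
(* With the invariance of [B], this makes B(F_n(z), w) balanced in n and w. *)
have Fg n g z : F (ract M (gr g) n) z = mod_act V (gr g^-1) (F n z).
  rewrite -comp_lfunE; congr (fun_of_lfun _ z); apply: tprod_eq => m v.
  rewrite comp_lfunE !FE /t linear_sum (reindex_inj (mulIg g)) /=.
  apply: eq_bigr => x _; rewrite linearZ /= ract_grM bg.
  by rewrite invMg act_grM.
have SP z : exists S : 'Hom(T, k^o), forall n w, S (tpure n w) = B (F n z) w.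
  apply: tprod_gr_lift => [w c n n'|n c w w'|g n w].
  - by rewrite F_lin form_linearl.
  - exact: form_linearr.
  - by rewrite Fg -(Binv g) -act_grM mulgV act_gr1.
pose S0 z := sval (boolp.cid (SP z)).
have S0E z n w : S0 z (tpure n w) = B (F n z) w.
  by rewrite /S0; case: boolp.cid.
have [c z z'|S SE] := @linear_lfun _ _ _ S0.
  apply: tprod_eq => n w; rewrite add_lfunE scale_lfunE !S0E.
  by rewrite linearP form_linearl.
exists S.
have Spure m v n w : S (tpure m v) (tpure n w) =
    \sum_g b (ract M (gr g) m) n * B (mod_act V (gr g^-1) v) w.
  rewrite SE S0E FE /t linear_sum sum_lfunE; apply: eq_bigr => g _.
  by rewrite linearZ scale_lfunE.
have Slin z : linear (S z) by move=> c y y'; rewrite linearP.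
have Slin' z : linear (S^~ z) by move=> c y y'; rewrite form_linearl.
have Tgr h m v :
    mod_act (tensor M V) (gr h) (tpure m v) = tpure (lact M (gr h) m) v.
  exact: mod_act_tensor.
split=> [h y z|y z|z zrad].
- apply: (@tprod_linear_eq k^o (fun y => S (mod_act (tensor M V) (gr h) y)
    (mod_act (tensor M V) (gr h) z)) (S^~ z)) => {y}[c y y'||m v].
  + by rewrite linearP form_linearl.
  + exact: Slin'.
  apply: (@tprod_linear_eq k^o (fun z => S (mod_act (tensor M V) (gr h)
    (tpure m v)) (mod_act (tensor M V) (gr h) z)) (S (tpure m v)))
    => {z}[c z z'||n w].
  + by rewrite linearP form_linearr.
  + exact: Slin.
  rewrite !Tgr !Spure; apply: eq_bigr => g _.
  by rewrite -lractC bh.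
- apply: (@tprod_linear_eq k^o (S^~ z) (S z)) => {y}[||m v]; try by [].
  apply: (@tprod_linear_eq k^o (S (tpure m v)) (S^~ (tpure m v))) => {z}[||n w];
    try by [].
  rewrite !Spure (reindex_inj invg_inj); apply: eq_bigr => g _ /=.
  rewrite -(bg g) -ract_grM mulVg ract_gr1 bsym invgK.
  by rewrite -(Binv g^-1%g) -act_grM mulVg act_gr1 Bsym.
pose e := vbasis {:M}.
have bMnd m : (forall n, bM m n = 0) -> m = 0.
  by move=> bm0; apply: bnd => n; rewrite -bME.
(* By non-degeneracy of [b], each coordinate of [a] is a pairing with some n_j; the trace formula
   then reads z = sum_j e_j (x) F_(n_j)(z). *)
have eP j : exists n, forall m, b m n = coord e j (a m).
  have [c m m'|f fE] := @linear_lfun _ M k^o (fun m => coord e j (a m)).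
    by rewrite !linearP.
  have [n nE] := nondegenerate_surj bMnd f.
  by exists n => m; rewrite bsym -bME nE fE.
pose n j := sval (boolp.cid (eP j)).
have nE j m : b m (n j) = coord e j (a m) by rewrite /n; case: boolp.cid.
have zE : z = \sum_(j < \dim {:M}) tpure e`_j (F (n j) z).
  apply: (@tprod_linear_eq T id
    (fun z => \sum_(j < \dim {:M}) tpure e`_j (F (n j) z)))
    => {z zrad}[//|c z z'|m v].
    rewrite scaler_sumr -big_split; apply: eq_bigr => j _.
    by rewrite linearP tpure_linearr.
  rewrite -[in LHS](aE m) tpure_suml (reindex_inj invg_inj) /=.
  under [RHS]eq_bigr => j _ do rewrite FE tpure_sumr.
  rewrite [RHS]exchange_big; apply: eq_bigr => g _ /=.
  rewrite tpure_bal invgK [in LHS](coord_vbasis (memvf (a _))) tpure_suml.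
  by apply: eq_bigr => j _; rewrite tpureZl tpureZr nE.
rewrite zE big1 // => j _; have -> : F (n j) z = 0.
  by apply: Bnd => w; rewrite -S0E -SE; apply: zrad.
by rewrite -(scale0r (0 : V)) tpureZr scale0r.
Qed.
End TensorProductGroup.

Theorem theoremC (k : closedFieldType) (char2 : 2%N \in [pchar k])
    (gT hT : finGroupType)
    (BG : {aspace gralg k gT}) (BH : {aspace gralg k hT})
    (blockG : block BG) (blockH : block BH)
    (M : bimodule (gralg k hT) (gralg k gT)) (moritaM : morita M BH BG)
    (symM : symmetric_type M)
    (P : fmod (algid BG)) (projP : projective P) (quadP : quadratic_type P) :
  projective (tensor_fmod (morita_l moritaM) P) /\
  quadratic_type (tensor M P).
Proof.
have idealG : ideal BG by case: blockG => [[]].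
have idealH : ideal BH by case: blockH => [[]].
have [projl _] := morita_progen_l moritaM.
have [projr _] := morita_progen_r moritaM.
have trP := projective_identity_is_trace idealG projP.
have trM : identity_is_trace (lside M) :=
  projective_identity_is_trace idealH projl.
have trMP := tensor_identity_is_trace trM trP.
split; first exact: identity_is_trace_projective.
have [B symB] := quadratic_type_symmetric char2 trP quadP.
have [S symS] := tensor_symmetric_nondegenerate
  (right_projective_trace idealG projr) symM symB.
exact: symmetric_quadratic_type char2 _ _ _ trMP symS.
Qed.
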